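(* Linear optimization over the partitioning orbitope $O^{=}_{p,q}$ can be solved in time $O(pq)$: there is an algorithm that, given integers $p\ge q\ge 1$ and an objective vector $d\in\mathbb{R}^{\mathcal{I}_{p,q}}$, computes in time $O(pq)$ an optimal solution of $\max\{\langle d,x\rangle : x\in O^{=}_{p,q}\}$.
   Context: Notation: $[n]=\{1,\dots,n\}$, $\mathcal{I}_{p,q}=\{(i,j)\in[p]\times[q] : i\ge j\}$. The partitioning orbitope $O^{=}_{p,q}$ is the convex hull of all 0/1-matrices of size $p\times q$ whose columns are in lexicographically decreasing (i.e., non-increasing, with row 1 the most significant position) order and that have exactly one 1-entry per row. Since no such matrix has a 1 above its main diagonal, the entries $(i,j)$ with $i<j$ are dropped and $O^{=}_{p,q}$ is regarded as a subset of $\mathbb{R}^{\mathcal{I}_{p,q}}$. Time is measured as the number of elementary operations, where arithmetic operations on and comparisons of real numbers have unit cost. *)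

(* Defs.v *)
From mathcomp Require Import all_boot all_order all_algebra.
From mathcomp Require Import classical_sets reals convex.
Set Implicit Arguments.
Unset Strict Implicit.
Unset Printing Implicit Defensive.
Import Order.TTheory GRing.Theory Num.Theory.
Local Open Scope classical_set_scope.
Local Open Scope ring_scope.

(* Rows and columns are numbered from 0; this shift does not affect i >= j. *)
Notation Iset p q :=
  {ij : 'I_p * 'I_q | (nat_of_ord ij.2 <= nat_of_ord ij.1)%N}.

Notation Ivec R p q := {ffun Iset p q -> R^o}.

Definition row_of p q (ij : Iset p q) : 'I_p := (sval ij).1.
Definition col_of p q (ij : Iset p q) : 'I_q := (sval ij).2.

Definition inner (R : realType) p q (d x : Ivec R p q) : R :=
  \sum_(ij : Iset p q) (d ij : R) * (x ij : R).

(* A boolean matrix stands for the 0/1-matrix with entries (M i j)%:R. *)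
Definition column p q (M : 'M[bool]_(p, q)) (j : 'I_q) : seq bool :=
  [seq M i j | i <- enum 'I_p].

Definition lex_noninc_columns p q (M : 'M[bool]_(p, q)) : Prop :=
  forall j k : 'I_q, (j <= k)%N ->
    ((column M k : seqlexi bool) <= (column M j : seqlexi bool))%O.

Definition one_per_row p q (M : 'M[bool]_(p, q)) : Prop :=
  forall i : 'I_p, #|[set j | M i j]%SET| = 1%N.

Definition drop_upper (R : realType) p q (M : 'M[bool]_(p, q)) : Ivec R p q :=
  [ffun ij => ((M (row_of ij) (col_of ij))%:R : R^o)].

Definition convex_hull (R : realType) (V : lmodType R) (A : set V) : set V :=
  [set x | forall C : set V, convex_set (C : set (convex_lmodType V)) ->
             A `<=` C -> C x].

Definition partitioning_orbitope (R : realType) (p q : nat) :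
    set (Ivec R p q) :=
  convex_hull [set x | exists M : 'M[bool]_(p, q),
    [/\ lex_noninc_columns M, one_per_row M & x = drop_upper R M]].
Arguments partitioning_orbitope : clear implicits.

Definition optimal_solution (R : realType) p q (d x : Ivec R p q) : Prop :=
  partitioning_orbitope R p q x /\
  forall y, partitioning_orbitope R p q y -> inner d y <= inner d x.

(* The machine model is a real RAM, presented as a structured language. The    *)
(* memory has arrays of natural numbers and arrays of real numbers, named and  *)
(* indexed by natural numbers; a scalar variable is cell 0 of an array. A      *)
(* program mentions finitely many array names, so several arrays amount to one *)
(* interleaved flat memory. On naturals only + and truncated - are available   *)
(* (no multiplication), and there is no conversion or rounding from reals to   *)
(* naturals: a real influences control flow only through comparisons.          *)
Record state (R : Type) := State {
  imem : nat -> nat -> nat;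
  rmem : nat -> nat -> R }.

Inductive iexp : Type :=
  | ICst of nat
  | IGet of nat & iexp
  | IAdd of iexp & iexp
  | ISub of iexp & iexp.

Inductive rexp : Type :=
  | RCst of nat
  | RGet of nat & iexp
  | RAdd of rexp & rexp
  | RSub of rexp & rexp
  | RMul of rexp & rexp
  | RDiv of rexp & rexp.

Inductive bexp : Type :=
  | ILe of iexp & iexp
  | RLe of rexp & rexp
  | BNot of bexp
  | BAnd of bexp & bexp.

Inductive cmd : Type :=
  | Skip
  | IPut of nat & iexp & iexp
  | RPut of nat & iexp & rexp
  | Seq of cmd & cmd
  | If of bexp & cmd & cmd
  | While of bexp & cmd.

Section Semantics.
Variable R : realType.
Implicit Types s : state R.

Fixpoint ieval s (e : iexp) : nat :=
  match e with
  | ICst n => n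
  | IGet a e1 => imem s a (ieval s e1)
  | IAdd e1 e2 => (ieval s e1 + ieval s e2)%N
  | ISub e1 e2 => (ieval s e1 - ieval s e2)%N
  end.

Fixpoint reval s (e : rexp) : R :=
  match e with
  | RCst n => n%:R
  | RGet a e1 => rmem s a (ieval s e1)
  | RAdd e1 e2 => reval s e1 + reval s e2
  | RSub e1 e2 => reval s e1 - reval s e2
  | RMul e1 e2 => reval s e1 * reval s e2
  | RDiv e1 e2 => reval s e1 / reval s e2
  end.

Fixpoint beval s (b : bexp) : bool :=
  match b with
  | ILe e1 e2 => (ieval s e1 <= ieval s e2)%N
  | RLe e1 e2 => reval s e1 <= reval s e2
  | BNot b1 => ~~ beval s b1
  | BAnd b1 b2 => beval s b1 && beval s b2
  end.

Definition upd (T : Type) (m : nat -> nat -> T) (a k : nat) (v : T) :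
    nat -> nat -> T :=
  fun a' k' => if (a' == a) && (k' == k) then v else m a' k'.

(* Unit cost: one operation per node of an expression (access, arithmetic      *)
(* operation, comparison or connective), and one more per executed assignment, *)
(* Skip, branching, and evaluation of a loop guard.                            *)
Fixpoint icost (e : iexp) : nat :=
  match e with
  | ICst _ => 1
  | IGet _ e1 => (icost e1).+1
  | IAdd e1 e2 | ISub e1 e2 => (icost e1 + icost e2).+1
  end.

Fixpoint rcost (e : rexp) : nat :=
  match e with
  | RCst _ => 1
  | RGet _ e1 => (icost e1).+1
  | RAdd e1 e2 | RSub e1 e2 | RMul e1 e2 | RDiv e1 e2 =>
      (rcost e1 + rcost e2).+1
  end.

Fixpoint bcost (b : bexp) : nat :=
  match b with
  | ILe e1 e2 => (icost e1 + icost e2).+1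
  | RLe e1 e2 => (rcost e1 + rcost e2).+1
  | BNot b1 => (bcost b1).+1
  | BAnd b1 b2 => (bcost b1 + bcost b2).+1
  end.

(* exec c s t s': started in s, c halts in s' after t elementary operations. *)
Inductive exec : cmd -> state R -> nat -> state R -> Prop :=
  | ExecSkip s : exec Skip s 1 s
  | ExecIPut s a k e :
      exec (IPut a k e) s (icost k + icost e).+1
        (State (upd (imem s) a (ieval s k) (ieval s e)) (rmem s))
  | ExecRPut s a k e :
      exec (RPut a k e) s (icost k + rcost e).+1
        (State (imem s) (upd (rmem s) a (ieval s k) (reval s e)))
  | ExecSeq c1 c2 s1 s2 s3 t1 t2 :
      exec c1 s1 t1 s2 -> exec c2 s2 t2 s3 ->
      exec (Seq c1 c2) s1 (t1 + t2)%N s3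
  | ExecIfTrue b c1 c2 s s' t :
      beval s b -> exec c1 s t s' ->
      exec (If b c1 c2) s (bcost b + t).+1 s'
  | ExecIfFalse b c1 c2 s s' t :
      ~~ beval s b -> exec c2 s t s' ->
      exec (If b c1 c2) s (bcost b + t).+1 s'
  | ExecWhileFalse b c s :
      ~~ beval s b -> exec (While b c) s (bcost b).+1 s
  | ExecWhileTrue b c s1 s2 s3 t1 t2 :
      beval s1 b -> exec c s1 t1 s2 -> exec (While b c) s2 t2 s3 ->
      exec (While b c) s1 (bcost b + t1 + t2).+1 s3.

Lemma exec_det c s t1 s1 t2 s2 :
  exec c s t1 s1 -> exec c s t2 s2 -> t1 = t2 /\ s1 = s2.
Proof.
move=> H; elim: H t2 s2 => {c s t1 s1}.
- by move=> s t2 s2 H; inversion H.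
- by move=> s a k e t2 s2 H; inversion H.
- by move=> s a k e t2 s2 H; inversion H.
- move=> c1 c2 r1 r2 r3 t1 t2 _ IH1 _ IH2 t s H.
  inversion H as [| | |? ? ? r ? u1 u2 E1 E2| | | |]; subst.
  have [? ?] := IH1 _ _ E1; subst.
  by have [-> ->] := IH2 _ _ E2.
- move=> b c1 c2 s s' t hb _ IH t2 s2 H.
  inversion H as [| | | |? ? ? ? ? ? _ E|? ? ? ? ? ? nb _| |]; subst.
    by have [-> ->] := IH _ _ E.
  by rewrite hb in nb.
- move=> b c1 c2 s s' t nb _ IH t2 s2 H.
  inversion H as [| | | |? ? ? ? ? ? hb _|? ? ? ? ? ? _ E| |]; subst.
    by rewrite hb in nb.
  by have [-> ->] := IH _ _ E.
- move=> b c s nb t2 s2 H.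
  inversion H as [| | | | | |? ? ? _|? ? ? ? ? ? ? hb _ _]; subst => //.
  by rewrite hb in nb.
- move=> b c r1 r2 r3 t1 t2 hb _ IH1 _ IH2 t s H.
  inversion H as [| | | | | |? ? ? nb|? ? ? ? ? ? ? _ E1 E2]; subst.
    by rewrite hb in nb.
  have [? ?] := IH1 _ _ E1; subst.
  by have [-> ->] := IH2 _ _ E2.
Qed.

End Semantics.

(* Vectors over Iset are laid out row by row with stride q; the cells of the   *)
(* dropped entries i < j, like all the rest of the memory, are arbitrary.      *)
Definition holds_vector (R : realType) p q (m : nat -> R) (x : Ivec R p q) :
    Prop :=
  forall ij : Iset p q, m (row_of ij * q + col_of ij)%N = x ij.

(* Input: p and q in natural arrays 0 and 1 (cell 0), d in real array 0.       *)
Definition input_state (R : realType) p q (d : Ivec R p q) (s : state R) :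
    Prop :=
  [/\ imem s 0 0 = p, imem s 1 0 = q & holds_vector (rmem s 0) d].

(* Output: real array 1. *)
Definition output_state (R : realType) p q (x : Ivec R p q) (s : state R) :
    Prop :=
  holds_vector (rmem s 1) x.

(* Main.v *)
Require Import Defs.
From mathcomp Require Import all_boot all_order all_algebra reals.
From mathcomp Require Import classical_sets interval_inference convex.
From mathcomp Require Import zify ring.
Set Implicit Arguments.
Unset Strict Implicit.
Unset Printing Implicit Defensive.
Import Order.TTheory GRing.Theory Num.Theory.
Local Open Scope ring_scope.

(* A vertex of the orbitope assigns to each row i a column f i, and its columns *)
(* are lexicographically sorted iff f is a restricted growth function: f i is   *)
(* at most the number c of columns used by the rows before i. The best          *)
(* completion of a partial assignment therefore depends only on (i, c), and     *)
(* row i either opens column c or takes the best old column j < c. The latter   *)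
(* is a running maximum, so each of the O(pq) pairs (i, c), scanned backwards   *)
(* in i and forwards in c, costs O(1); the optimal f is then read off forwards. *)

(** * Lexicographic order and restricted growth *)

(** By [vertex_assignment], [assignment_lex] and [assignment_one_per_row], the generating matrices
    are exactly the assignments of restricted growth functions, on which [inner d] is a sum over
    rows ([inner_assignment]). The Bellman inequality [row_value_ge] bounds every such sum by
    [value] ([total_le_value]), and [greedy] attains the bound ([total_greedy]). The half-space of
    [inner_le_convex] carries it over to the convex hull. Loop invariants then show that [program]
    fills the table of choices backwards and traces [greedy] forwards, spending a bounded number of
    operations on each of the O(pq) table and output cells. *)

Lemma lexi_bool_first (s t : seq bool) (i : nat) :
  size s = size t -> ((s : seqlexi bool) <= (t : seqlexi bool))%O ->
  nth false s i -> exists2 k, (k <= i)%N & nth false t k.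
Proof.
elim: s t i => [|x s IH] [|y t] i //=; first by rewrite nth_nil.
move=> [sz]; rewrite lexi_cons => /andP[xy ys].
case: y xy ys => xy ys; first by exists 0%N.
case: x xy ys => //= _ st; case: i => [//|i] /= si.
by have [k ki tk] := IH _ _ sz st si; exists k.+1.
Qed.

(** Up to and including the first 1 of [t], [s] has no 1, so the first difference, if any, favours
    [t]. *)
Lemma lexi_bool_preceded (s t : seq bool) :
  size s = size t ->
  (forall i, nth false s i -> exists2 k, (k < i)%N & nth false t k) ->
  ((s : seqlexi bool) <= (t : seqlexi bool))%O.
Proof.
elim: s t => [|x s IH] [|y t] //= [sz] prec; rewrite lexi_cons.
case: x prec => prec; first by have [] := prec 0%N isT.
case: y prec => prec //=; apply: IH => // i si.
by have [[|k] // ki tk] := prec i.+1 si; exists k.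
Qed.

Definition next_used (c j : nat) : nat := if (c <= j)%N then c.+1 else c.

Fixpoint used (f : nat -> nat) (i : nat) : nat :=
  if i is k.+1 then next_used (used f k) (f k) else 0.

Definition restricted_growth (p q : nat) (f : nat -> nat) : Prop :=
  forall i, (i < p)%N -> (f i < q)%N /\ (f i <= used f i)%N.

Section RestrictedGrowth.
Variables (p q : nat) (f : nat -> nat).

Lemma used_le_row i : (used f i <= i)%N.
Proof. by elim: i => //= i IH; rewrite /next_used; case: ifP => _; lia. Qed.

(** The growth bound is assumed only below [i]: this is all that is known inside the strong
    induction of [vertex_assignment]. *)
Lemma used_gt k i : (k < i)%N ->
   (forall l, (l < i)%N -> (f l <= used f l)%N) -> (f k < used f i)%N.
Proof.
elim: i => //= i IH; rewrite ltnS leq_eqVlt => /orP[/eqP->|ki] gr.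
  by have := gr i (ltnSn i); rewrite /next_used; case: ifP; lia.
have := IH ki (fun l li => gr l (ltnW li)).
by rewrite /next_used; case: ifP => _; lia.
Qed.

Hypothesis rg : restricted_growth p q f.

Lemma used_le i : (i <= p)%N -> (used f i <= q)%N.
Proof.
elim: i => //= i IH ip; have [fq fu] := rg ip; have := IH (ltnW ip).
by rewrite /next_used; case: ifP; lia.
Qed.

Lemma used_onto i j :
  (i <= p)%N -> (j < used f i)%N -> exists2 k, (k < i)%N & f k = j.
Proof.
elim: i => //= i IH ip; have [fq fu] := rg ip; rewrite /next_used.
case: ifP => uf; last first.
  by move=> /(IH (ltnW ip))[k ki <-]; exists k => //; lia.
rewrite ltnS leq_eqVlt => /orP[/eqP->|/(IH (ltnW ip))[k ki <-]].
  by exists i => //; lia.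
by exists k => //; lia.
Qed.

End RestrictedGrowth.

(** * Vertices as restricted growth functions *)

Definition assignment_mx p q (f : nat -> nat) : 'M[bool]_(p, q) :=
  \matrix_(i < p, j < q) (f i == j).

Lemma nth_column p q (M : 'M[bool]_(p, q)) (j : 'I_q) (i : 'I_p) :
  nth false (column M j) i = M i j.
Proof.
by rewrite (nth_map i) ?size_enum_ord // nth_ord_enum.
Qed.

Lemma size_column p q (M : 'M[bool]_(p, q)) (j : 'I_q) :
  size (column M j) = p.
Proof. by rewrite size_map size_enum_ord. Qed.

Lemma nth_columnP p q (M : 'M[bool]_(p, q)) (j : 'I_q) (i : nat) :
  nth false (column M j) i -> exists2 k : 'I_p, i = k & M k j.
Proof.
case: (ltnP i p) => ip; last by rewrite nth_default ?size_column.
by rewrite -[i]/(nat_of_ord (Ordinal ip)) nth_column; exists (Ordinal ip).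
Qed.

Section Vertices.
Variables (p q : nat).

Lemma assignment_one_per_row f :
  restricted_growth p q f -> one_per_row (assignment_mx p q f).
Proof.
move=> rg i; have [fq _] := rg i (ltn_ord i).
rewrite -(cards1 (Ordinal fq)); congr #|pred_of_set _|.
by apply/setP => j; rewrite !inE mxE eq_sym.
Qed.

(** If row [i] uses column [k > j], then more than [j] columns are used before it, so column [j] has
    a 1 strictly earlier. *)
Lemma assignment_lex f :
  restricted_growth p q f -> lex_noninc_columns (assignment_mx p q f).
Proof.
move=> rg j k; rewrite leq_eqVlt => /orP[/eqP/val_inj->//|jk].
apply: lexi_bool_preceded; rewrite ?size_column // => _ /nth_columnP[i ->].
rewrite mxE => /eqP fi; have [_ fu] := rg i (ltn_ord i).
have [|l li fl] := @used_onto p q f rg i j (ltnW (ltn_ord i)); first lia.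
exists l => //; have lp := ltn_trans li (ltn_ord i).
by rewrite -[l]/(nat_of_ord (Ordinal lp)) nth_column mxE fl.
Qed.

Lemma vertex_assignment (M : 'M[bool]_(p, q)) :
  lex_noninc_columns M -> one_per_row M ->
  exists2 f, restricted_growth p q f & M = assignment_mx p q f.
Proof.
move=> lexM oneM.
have ex i : exists j : 'I_q, [forall k, M i k == (j == k)].
  have /eqP/cards1P[j Mj] := oneM i; exists j; apply/forallP => k.
  by move/setP/(_ k): Mj; rewrite !inE eq_sym => ->.
pose f i := if insub i is Some i' then val (sval (sigW (ex i'))) else 0%N.
have fE (i : 'I_p) : f i = sval (sigW (ex i)) by rewrite /f valK.
have MfE i j : M i j = (f i == j).
  by rewrite fE; move/forallP/(_ j)/eqP: (svalP (sigW (ex i))) => ->;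
    rewrite -val_eqE.
exists f; last by apply/matrixP => i j; rewrite mxE MfE.
elim/ltn_ind => n IH np.
have fE' := fE (Ordinal np); rewrite /= in fE'.
split; first by rewrite fE' ltn_ord.
(* Column [j] is lexicographically at least column [j.+1], so some row [k <= n] uses [j]; row [n]
   does not, hence [k < n]. *)
case fn: (f n) => [//|j].
have jq : (j.+1 < q)%N by rewrite -fn fE' ltn_ord.
have := lexM (Ordinal (ltnW jq)) (Ordinal jq) (leqnSn j).
move=> /(@lexi_bool_first _ _ n); rewrite !size_column => /(_ erefl).
rewrite -[n in nth _ _ n]/(nat_of_ord (Ordinal np)) nth_column MfE /= fn eqxx.
case=> // k kn /nth_columnP[l kl]; rewrite MfE -kl => /eqP /= fk.
have {}kn : (k < n)%N.
  by rewrite ltn_neqAle kn andbT; apply/eqP => kn'; rewrite kn' fn in fk; lia.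
rewrite -fk; apply: used_gt => // m mn.
by have [] := IH m mn (ltn_trans mn np).
Qed.

End Vertices.

(** * Dynamic program over pairs (row, number of used columns) *)

(* [D] also has values above the diagonal; they are arbitrary, and harmless     *)
(* because a restricted growth function satisfies [f i <= i].                   *)
Section DynamicProgram.
Variables (R : realDomainType) (p q : nat) (D : nat -> nat -> R).

(* At [c = 0] there is no old column and [best_old] is the junk value [0]. *)
Fixpoint best_old (r : nat -> R) (c : nat) : nat :=
  if c is k.+1 then if r (best_old r k) <= r k then k else best_old r k else 0.

(** The nested negations mirror the guard [opens_test], whose language has no disjunction; the test
    [1 <= c] discards the junk value of [best_old] at 0. *)
Definition opens_column (r W : nat -> R) (c : nat) : bool :=
  (c.+1 <= q)%N &&
  ~~ ((1 <= c)%N && ~~ (r (best_old r c) + W c <= r c + W c.+1)).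

Definition row_choice (r W : nat -> R) (c : nat) : nat :=
  if opens_column r W c then c else best_old r c.

Definition row_value (r W : nat -> R) (c : nat) : R :=
  r (row_choice r W c) + W (next_used c (row_choice r W c)).

(** Counting the remaining rows makes the backward recursion structural. *)
Fixpoint tail_value (k : nat) : nat -> R :=
  if k is l.+1 then row_value (D (p - l.+1)%N) (tail_value l) else fun=> 0.

(* The optimum over the rows from [i] on, when the rows before [i] use exactly *)
(* the columns [j < c].                                                        *)
Definition value (i : nat) : nat -> R := tail_value (p - i).

Definition choice (i c : nat) : nat := row_choice (D i) (value i.+1) c.

Fixpoint greedy_used (i : nat) : nat :=
  if i is k.+1 then next_used (greedy_used k) (choice k (greedy_used k)) else 0.

Definition greedy (i : nat) : nat := choice i (greedy_used i).

Definition total (f : nat -> nat) (i : nat) : R := \sum_(i <= k < p) D k (f k).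

Lemma value_row i c : (i < p)%N -> value i c = row_value (D i) (value i.+1) c.
Proof.
move=> ip; rewrite /value; have -> : (p - i = (p - i.+1).+1)%N by lia.
by rewrite /=; congr (row_value (D _)); lia.
Qed.

Lemma value_end c : value p c = 0.
Proof. by rewrite /value subnn. Qed.

Lemma best_old_lt r c : (0 < c)%N -> (best_old r c < c)%N.
Proof.
elim: c => //= c IH _; case: ifP => // _.
by case: c IH => //= c /(_ isT) /ltnW.
Qed.

Lemma best_oldP r c j : (j < c)%N -> r j <= r (best_old r c).
Proof.
elim: c => //= c IH; rewrite ltnS leq_eqVlt.
case: ifP => [rc|/negbT]; last rewrite -ltNge => /ltW rc.
  by move=> /orP[/eqP->//|/IH /le_trans->].
by move=> /orP[/eqP->//|/IH].
Qed.

Lemma row_choice_le r W c : (row_choice r W c <= c)%N.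
Proof.
rewrite /row_choice; case: ifP => // _.
by case: c => // c; exact/ltnW/best_old_lt.
Qed.

Lemma row_choice_lt r W c : (0 < q)%N -> (c <= q)%N -> (row_choice r W c < q)%N.
Proof.
move=> q0 cq; rewrite /row_choice /opens_column; case: ifP => [/andP[]//|].
by case: c cq => [|c] cq; rewrite ?q0 // => _;
  apply: leq_trans cq; apply: best_old_lt.
Qed.

Lemma row_value_old r W c : ~~ opens_column r W c -> (0 < c)%N ->
  row_value r W c = r (best_old r c) + W c.
Proof.
move=> /negbTE opc c0; rewrite /row_value /row_choice opc /next_used.
by rewrite leqNgt best_old_lt.
Qed.

Lemma row_value_new r W c : opens_column r W c ->
  row_value r W c = r c + W c.+1.
Proof. by move=> opc; rewrite /row_value /row_choice opc /next_used leqnn. Qed.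

(** Bellman inequality: an old column is dominated by [best_old], and the only new column allowed is
    [c] itself. *)
Lemma row_value_ge r W c j : (c <= q)%N -> (j < q)%N -> (j <= c)%N ->
  r j + W (next_used c j) <= row_value r W c.
Proof.
move=> cq jq jc; have [opc|opc] := boolP (opens_column r W c).
  rewrite row_value_new //; rewrite /next_used.
  case: ifP => [cj|/negbT]; first by have -> : j = c by lia.
  rewrite -ltnNge => {}jc; move: opc; rewrite /opens_column.
  case/andP => _; rewrite negb_and negbK => /orP[|]; first lia.
  by apply: le_trans; rewrite lerD2r best_oldP.
(* No column is opened for one of two reasons: [c = q], and then [j] is old, or the best old column
   is strictly better. *)
move: (opc); rewrite /opens_column negb_and negbK.
case/orP => [cq'|/andP[c0 lt]]; last first.
  rewrite row_value_old //; rewrite /next_used; case: ifP => [cj|/negbT].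
    have -> : j = c by lia.
    by move: lt; rewrite -ltNge => /ltW.
  by rewrite -ltnNge => {}jc; rewrite lerD2r best_oldP.
rewrite row_value_old //; last lia.
by rewrite /next_used leqNgt (_ : (j < c)%N) ?lerD2r ?best_oldP //; lia.
Qed.

Lemma total_le_value f i : restricted_growth p q f -> (i <= p)%N ->
  total f i <= value i (used f i).
Proof.
(* With [i = p - n], backward induction over the rows becomes induction on [n]. *)
move=> rg ip; rewrite /total -(subKn ip); set n := (p - i)%N.
have: (n <= p)%N by rewrite /n leq_subr.
elim: n => [|n IH] np; first by rewrite subn0 big_geq // value_end.
have lt : (p - n.+1 < p)%N by lia.
have [fq fu] := rg _ lt; have uq := used_le rg (ltnW lt).
rewrite big_ltn // value_row //; apply: le_trans (row_value_ge _ _ uq fq fu).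
by rewrite lerD2l (subnSK np) (le_trans (IH (ltnW np))) // -(subnSK np).
Qed.

Lemma used_greedy i : used greedy i = greedy_used i.
Proof. by elim: i => //= i ->. Qed.

Lemma greedy_restricted_growth : (0 < q)%N -> restricted_growth p q greedy.
Proof.
move=> q0.
have uq i : (greedy_used i <= q)%N.
  elim: i => //= i IH; rewrite /next_used; case: ifP => // le.
  have := row_choice_lt (D i) (value i.+1) q0 IH.
  by move: le; rewrite /choice; lia.
move=> i _; rewrite used_greedy /greedy /choice row_choice_le.
by rewrite row_choice_lt.
Qed.

Lemma total_greedy i : (i <= p)%N -> total greedy i = value i (greedy_used i).
Proof.
move=> ip; rewrite /total -(subKn ip); set n := (p - i)%N.
have: (n <= p)%N by rewrite /n leq_subr.
elim: n => [|n IH] np; first by rewrite subn0 big_geq // value_end.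
have lt : (p - n.+1 < p)%N by lia.
rewrite big_ltn // value_row // /row_value; congr (_ + _).
by rewrite (subnSK np) IH ?(ltnW np) // -(subnSK np).
Qed.

Lemma total_greedy_max f :
  restricted_growth p q f ->
  total f 0 <= total greedy 0.
Proof. by move=> rg; rewrite total_greedy // total_le_value. Qed.

End DynamicProgram.

(** * From vertices to the convex hull *)

Section Optimality.
Variables (R : realType) (p q : nat) (d : Ivec R p q) (D : nat -> nat -> R).
Hypothesis dD : forall ij, D (row_of ij) (col_of ij) = d ij.

(** Dropping the upper entries loses nothing: [f i <= used f i <= i] puts the single 1 of row [i]
    inside [Iset]. *)
Lemma inner_assignment f : restricted_growth p q f ->
  inner d (drop_upper R (assignment_mx p q f)) = total p D f 0.
Proof.
move=> rg; rewrite /inner /total big_mkord.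
rewrite (partition_big (@row_of p q) predT) //=; apply: eq_bigr => i _.
have [fq fu] := rg i (ltn_ord i).
have fi : (Ordinal fq <= i)%N := leq_trans fu (used_le_row f i).
pose ij : Iset p q := exist _ (i, Ordinal fq) fi.
rewrite (bigD1 ij) //= big1 => [|kl /andP[/eqP rkl klij]].
  by rewrite ffunE mxE eqxx mulr1 addr0 -dD.
rewrite ffunE mxE rkl; case: eqP => [fcol|_]; last by rewrite mulr0.
case/eqP: klij; apply: val_inj; case: kl rkl fcol => [[k l] /= kl].
by rewrite /row_of /col_of /= => -> fcol; congr (_, _); apply: val_inj.
Qed.

Lemma inner_convD (x y : Ivec R p q) (a b : R) :
  inner d (a *: x + b *: y) = a * inner d x + b * inner d y.
Proof.
rewrite /inner !mulr_sumr -big_split /=; apply: eq_bigr => ij _.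
by rewrite !ffunE /= mulrDr; congr (_ + _); rewrite mulrCA.
Qed.

(** The hull is the intersection of all convex supersets, so a bound valid on the vertices extends
    to it by testing against this half-space. *)
Lemma inner_le_convex (u : R) :
  convex_set ([set y : Ivec R p q | inner d y <= u]%classic
    : set (convex_lmodType (Ivec R p q))).
Proof.
move=> x y l /set_mem /= xu /set_mem /= yu; apply/mem_set => /=.
rewrite [X in inner d X](_ : _ = l%:num *: x + (1 - l%:num) *: y) //.
rewrite inner_convD.
have -> : u = l%:num * u + (1 - l%:num) * u by ring.
by rewrite lerD // ler_wpM2l // subr_ge0.
Qed.

Lemma greedy_optimal : (0 < q)%N ->
  optimal_solution d (drop_upper R (assignment_mx p q (greedy p q D))).
Proof.
move=> q0; have rg : restricted_growth p q (greedy p q D).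
  exact: greedy_restricted_growth.
split=> [C _|y].
  apply=> /=; exists (assignment_mx p q (greedy p q D)).
  by split=> //; [exact: assignment_lex|exact: assignment_one_per_row].
set x := drop_upper _ _ => hull_y.
apply: (hull_y [set z | inner d z <= inner d x]%classic).
  exact: (@inner_le_convex (inner d x)).
move=> _ /= [M [lexM oneM ->]]; have [f rgf ->] := vertex_assignment lexM oneM.
by rewrite !inner_assignment // total_greedy_max.
Qed.

End Optimality.

(** * The program and its correctness *)

Section ProgramLogic.
Variable R : realType.
Implicit Types (s : state R) (P Q : state R -> Prop).

Definition runs (c : cmd) s (T : nat) Q : Prop :=
  exists t s', [/\ exec c s t s', (t <= T)%N & Q s'].

(* Weakest precondition and cost bound of a loop-free command. *)
Fixpoint wp (c : cmd) Q s : Prop :=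
  match c with
  | Skip => Q s
  | IPut a k e => Q (State (upd (imem s) a (ieval s k) (ieval s e)) (rmem s))
  | RPut a k e => Q (State (imem s) (upd (rmem s) a (ieval s k) (reval s e)))
  | Seq c1 c2 => wp c1 (wp c2 Q) s
  | If b c1 c2 => if beval s b then wp c1 Q s else wp c2 Q s
  | While _ _ => False
  end.

Fixpoint cost (c : cmd) : nat :=
  match c with
  | Skip => 1
  | IPut _ k e => (icost k + icost e).+1
  | RPut _ k e => (icost k + rcost e).+1
  | Seq c1 c2 => cost c1 + cost c2
  | If b c1 c2 => (bcost b + (cost c1 + cost c2)).+1
  | While _ _ => 0
  end.

(** Loops are excluded because their [wp] is [False]; charging both branches of an [If] makes [cost]
    independent of the state. *)
Lemma runs_wp c s Q : wp c Q s -> runs c s (cost c) Q.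
Proof.
elim: c s Q => [|a k e|a k e|c1 IH1 c2 IH2|b c1 IH1 c2 IH2|//] s Q /=.
- by exists 1%N, s; split => //; exact: ExecSkip.
- by move=> Qs; do 2!eexists; split; [exact: ExecIPut| |exact: Qs].
- by move=> Qs; do 2!eexists; split; [exact: ExecRPut| |exact: Qs].
- move=> /IH1[t1 [s1 [E1 t1le /IH2[t2 [s2 [E2 t2le Qs2]]]]]].
  by exists (t1 + t2)%N, s2; split=> //; [exact: ExecSeq E2|exact: leq_add].
- case: ifPn => b_s.
    move=> /IH1[t [s' [E tle Qs']]]; exists (bcost b + t).+1, s'.
    by split => //; [exact: ExecIfTrue|lia].
  move=> /IH2[t [s' [E tle Qs']]]; exists (bcost b + t).+1, s'.
  by split => //; [exact: ExecIfFalse|lia].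
Qed.

Lemma runs_weaken c s T1 T2 P Q : runs c s T1 P -> (T1 <= T2)%N ->
  (forall s', P s' -> Q s') -> runs c s T2 Q.
Proof.
move=> [t [s' [E tT1 Ps']]] T12 PQ; exists t, s'.
by split; [|exact: leq_trans T12|exact: PQ].
Qed.

Lemma runs_seq c1 c2 s T1 T2 P Q : runs c1 s T1 P ->
  (forall s', P s' -> runs c2 s' T2 Q) -> runs (Seq c1 c2) s (T1 + T2) Q.
Proof.
move=> [t1 [s1 [E1 t1le /[swap] PQ /PQ[t2 [s2 [E2 t2le Qs2]]]]]].
by exists (t1 + t2)%N, s2; split=> //; [exact: ExecSeq E2|exact: leq_add].
Qed.

Lemma runs_while b c (I : nat -> state R -> Prop) n T s :
  (forall k s1, (k < n)%N -> I k s1 -> beval s1 b /\ runs c s1 T (I k.+1)) ->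
  (forall s1, I n s1 -> ~~ beval s1 b) -> I 0 s ->
  runs (While b c) s (n * (bcost b + T).+1 + (bcost b).+1) (I n).
Proof.
move=> step stop Is0.
(* Induction on the number [m] of iterations still to come. *)
suff loop m s1 : (m <= n)%N -> I (n - m)%N s1 ->
    runs (While b c) s1 (m * (bcost b + T).+1 + (bcost b).+1) (I n).
  by apply: loop => //; rewrite subnn.
elim: m s1 => [|m IH] s1 mn Is.
  rewrite subn0 in Is; exists (bcost b).+1, s1.
  by split=> //; exact/ExecWhileFalse/stop.
have nm : (n - m.+1 < n)%N by lia.
have [b_s [t1 [s2 [E1 t1le]]]] := step _ _ nm Is.
rewrite subnSK // => /(IH _ (ltnW mn))[t2 [s3 [E2 t2le Is3]]].
exists (bcost b + t1 + t2).+1, s3; split=> //; first exact: ExecWhileTrue E2.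
by move: t1le t2le; rewrite mulSn; lia.
Qed.

End ProgramLogic.

(** * The program *)

Definition Var a := IGet a (ICst 0).
Definition Assign a e := IPut a (ICst 0) e.
(* [vb] contains [i * q], [aT] the choices of the dynamic program, [aW] its     *)
(* current row of values, and [aX] the output.                                  *)
Notation vp := 0%N (only parsing).
Notation vq := 1%N (only parsing).
Notation vi := 2%N (only parsing).
Notation vb := 3%N (only parsing).
Notation vc := 4%N (only parsing).
Notation vj := 5%N (only parsing).
Notation aT := 6%N (only parsing).
Notation aD := 0%N (only parsing).
Notation aX := 1%N (only parsing).
Notation aW := 2%N (only parsing).

Definition incr a := Assign a (IAdd (Var a) (ICst 1)).
Definition entry e := RGet aD (IAdd (Var vb) e).
(* Stride [q + 1], since the number of used columns ranges over [0 .. q]. *)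
Definition cell_T := IAdd (IAdd (Var vb) (Var vi)) (Var vc).

(** Naturals have no product, so [p * q] is accumulated by additions; the same loop clears entries
    [0..p] of [aW], which include [0..q] as [q <= p]. *)
Definition init_body : cmd :=
  Seq (incr vi)
 (Seq (Assign vb (IAdd (Var vb) (Var vq)))
      (RPut aW (Var vi) (RCst 0))).

Definition init : cmd :=
  Seq (Seq (Assign vi (ICst 0)) (Seq (Assign vb (ICst 0))
        (RPut aW (ICst 0) (RCst 0))))
      (While (BNot (ILe (Var vp) (Var vi))) init_body).

(* Guards evaluate all their operands: at [c = 0] or [c = q] the comparison of  *)
(* reals is meaningless, but its outcome is ignored.                            *)
Definition opens_test : bexp :=
  BAnd (ILe (IAdd (Var vc) (ICst 1)) (Var vq))
       (BNot (BAnd (ILe (ICst 1) (Var vc))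
         (BNot (RLe (RAdd (entry (Var vj)) (RGet aW (Var vc)))
                    (RAdd (entry (Var vc)) (RGet aW (IAdd (Var vc) (ICst 1)))))))).

(* The row values are updated in place: the entries at [c] and [c + 1] still     *)
(* belong to the row below when [c] is treated.                                 *)
Definition relax_body : cmd :=
  Seq (If opens_test
        (Seq (IPut aT cell_T (Var vc))
             (RPut aW (Var vc)
                (RAdd (entry (Var vc)) (RGet aW (IAdd (Var vc) (ICst 1))))))
        (Seq (IPut aT cell_T (Var vj))
             (RPut aW (Var vc) (RAdd (entry (Var vj)) (RGet aW (Var vc))))))
 (Seq (If (RLe (entry (Var vj)) (entry (Var vc)))
        (Assign vj (Var vc)) Skip)
      (incr vc)).

Definition row_body : cmd :=
  Seq (Seq (Assign vi (ISub (Var vi) (ICst 1)))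
      (Seq (Assign vb (ISub (Var vb) (Var vq)))
      (Seq (Assign vc (ICst 0)) (Assign vj (ICst 0)))))
      (While (ILe (Var vc) (Var vq)) relax_body).

Definition clear_body : cmd :=
  Seq (RPut aX (IAdd (Var vb) (Var vj)) (RCst 0)) (incr vj).

(** [cell_T] depends on [vb], [vi] and [vc], so the output and the test read it before any of them
    changes. *)
Definition mark : cmd :=
  Seq (RPut aX (IAdd (Var vb) (IGet aT cell_T)) (RCst 1))
 (Seq (If (ILe (Var vc) (IGet aT cell_T)) (incr vc) Skip)
 (Seq (incr vi)
      (Assign vb (IAdd (Var vb) (Var vq))))).

Definition trace_body : cmd :=
  Seq (Assign vj (ICst 0))
 (Seq (While (BNot (ILe (Var vq) (Var vj))) clear_body) mark).

Definition program : cmd :=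
  Seq init
 (Seq (While (ILe (ICst 1) (Var vi)) row_body)
 (Seq (Assign vc (ICst 0))
      (While (BNot (ILe (Var vp) (Var vi))) trace_body))).

(** * Loop invariants and running time *)

Section Correctness.
Variables (R : realType) (p q : nat) (m : nat -> R).
Hypothesis q_gt0 : (0 < q)%N.
Hypothesis qp : (q <= p)%N.
Implicit Type s : state R.
Let D (i j : nat) : R := m (i * q + j)%N.
Let V := value p q D.
Let T := choice p q D.

Definition at_row (i : nat) s : Prop :=
  [/\ imem s vp 0 = p, imem s vq 0 = q, imem s vi 0 = i,
      imem s vb 0 = (i * q)%N & forall k, rmem s aD k = m k].

Definition stores_choices (i c : nat) s : Prop :=
  forall k l, (k < p)%N -> (l <= q)%N -> (i < k)%N || (i == k) && (l < c)%N ->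
  imem s aT (k * q + k + l) = T k l.

Definition init_inv k s : Prop :=
  at_row k s /\ forall l, (l <= k)%N -> rmem s aW l = 0.

(** [c] counts the finished entries of row [i] and [e] is the loop counter; they differ only between
    the table update and the updates of [vj] and [vc]. *)
Definition relax_inv i c e s : Prop :=
  [/\ at_row i s, imem s vc 0 = e, imem s vj 0 = best_old (D i) e,
      stores_choices i c s &
      forall l, (l <= q)%N ->
        rmem s aW l = if (l < c)%N then V i l else V i.+1 l].

Definition row_inv k s : Prop :=
  [/\ at_row (p - k) s, stores_choices (p - k) q.+1 s &
      forall l, (l <= q)%N -> rmem s aW l = V (p - k) l].

Definition trace_inv k s : Prop :=
  [/\ at_row k s, imem s vc 0 = greedy_used p q D k, stores_choices 0 q.+1 s &
      forall i j, (i < k)%N -> (j < q)%N ->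
        rmem s aX (i * q + j)%N = (greedy p q D i == j)%:R].

Definition clear_inv k j s : Prop :=
  [/\ trace_inv k s, imem s vj 0 = j &
      forall l, (l < j)%N -> rmem s aX (k * q + l)%N = 0].

Lemma runs_init s : imem s vp 0 = p -> imem s vq 0 = q ->
  (forall k, rmem s aD k = m k) -> runs init s (100 * p) (init_inv p).
Proof.
move=> sp sq sD; apply: (@runs_weaken _ _ _ _ _ (init_inv p)); last by [].
  apply: (@runs_seq _ _ _ _ _ _ (init_inv 0)).
    by apply: runs_wp => /=; rewrite /upd /=; split=> //=; case.
  move=> s' s'I; apply: runs_while s'I => [k s1|s1].
    move=> kp [[ep eq ei eb eD] eW] /=; rewrite ep ei -ltnNge; split=> //.
    apply: runs_wp => /=; rewrite /upd /= ei eb eq; split => /=.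
      by split => //=; rewrite ?addn1 // mulSn addnC.
    move=> l; rewrite addn1; case: eqP => // /eqP lk lk1; apply: eW; lia.
  by case=> -[ep _ ei _ _] _ /=; rewrite ep ei leqnn.
by rewrite /=; lia.
Qed.

Lemma opens_testE i c s : (c <= q)%N -> relax_inv i c c s ->
  beval s opens_test = opens_column q (D i) (V i.+1) c.
Proof.
move=> cq [[ep eq ei eb eD] ec ej _ eW]; rewrite /opens_column /=.
rewrite eq ec ej eb !eD addn1; case: (ltnP c q) => //= {}cq.
by rewrite !eW ?ltnn ?(ltnNge c.+1 c) ?leqnSn // ltnW.
Qed.

Lemma stores_choices_upd i c s s' : (c <= q)%N ->
  imem s' aT = upd (imem s) aT (i * q + i + c) (T i c) aT ->
  stores_choices i c s -> stores_choices i c.+1 s'.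
Proof.
move=> cq s'T sc k l kp lq ikl; rewrite s'T /upd eqxx /=.
case: eqP => [e|/eqP ne].
  (* Both [l] and [c] are at most [q], so with stride [q + 1] equal addresses force equal rows. *)
  have ki : k = i by move: e ikl; nia.
  by rewrite ki; congr (T _ _); move: e; rewrite ki; lia.
apply: sc => //; case/orP: ikl => [->//|/andP[/eqP ik]].
by move: ne; rewrite -ik eqxx; lia.
Qed.

Lemma runs_relax i c s : (i < p)%N -> (c <= q)%N -> relax_inv i c c s ->
  runs relax_body s 200 (relax_inv i c.+1 c.+1).
Proof.
move=> ip cq sI; have test := opens_testE cq sI.
move: sI => [[ep eq ei eb eD] ec ej eT eW].
apply: (@runs_weaken _ _ _ _ _ (relax_inv i c.+1 c.+1)); last by [].
  apply: (@runs_seq _ _ _ _ _ _ (relax_inv i c.+1 c)).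
    apply: runs_wp; cbn [wp]; rewrite test; case: ifPn => opc.
      rewrite /= ec ei eb eD addn1; split=> //=.
        by apply: stores_choices_upd eT => //=;
          rewrite /T /choice /row_choice opc.
      move=> l lq; rewrite /upd /= ?ec ?ej ?eb ?eD; case: eqP => [->|/eqP lc].
        rewrite ltnSn /V value_row // row_value_new // eW.
          by rewrite (ltnNge c.+1 c) leqnSn.
        by case/andP: opc.
      by rewrite eW // (ltnS l c) (leq_eqVlt l c) (negbTE lc).
    rewrite /= ec ej ei eb eD; split=> //=.
      apply: stores_choices_upd eT => //=.
      by rewrite /T /choice /row_choice (negbTE opc).
    move=> l lq; rewrite /upd /= ?ec ?ej ?eb ?eD; case: eqP => [->|/eqP lc].
      rewrite ltnSn /V value_row // row_value_old //; last first.
        (* At [c = 0] a column is always opened, because [q > 0]. *)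
        by move: opc; rewrite /opens_column; lia.
      by rewrite eW // ltnn.
    by rewrite eW // (ltnS l c) (leq_eqVlt l c) (negbTE lc).
  move=> s1 [[{}ep {}eq {}ei {}eb {}eD] {}ec {}ej {}eT {}eW].
  apply: runs_wp => /=; rewrite ec ej eb !eD.
  rewrite -/(D i c) -/(D i (best_old (D i) c)).
  by case: ifPn => le; split;
    rewrite /upd //= ?ec ?addn1 // ?ej ?le ?(negbTE le).
by [].
Qed.

Lemma runs_row k s : (k < p)%N -> row_inv k s ->
  runs row_body s (500 * q) (row_inv k.+1).
Proof.
move=> kp [[ep eq ei eb eD] eT eW]; set i := (p - k.+1)%N.
have iS : (p - k = i.+1)%N by rewrite /i; lia.
rewrite iS in ei eb eT eW.
apply: (@runs_weaken _ _ _ _ _ (relax_inv i q.+1 q.+1)).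
- apply: (@runs_seq _ _ _ _ _ _ (relax_inv i 0 0)).
    apply: runs_wp => /=; rewrite /upd /= ei eb eq subn1; split=> //=.
      by split=> //=; rewrite mulSn addKn.
    move=> a l ap lq /orP[ia|/andP[]//]; apply: eT => //; lia.
  move=> s1; apply: (@runs_while _ _ _ (fun c => relax_inv i c c)).
    move=> c s2 cq s2I; split; last by apply: runs_relax => //; rewrite /i; lia.
    by case: s2I => -[_ /= -> _ _ _] -> _ _ _.
  by move=> s2 [[_ /= -> _ _ _] -> _ _ _]; rewrite ltnn.
(* Since [q >= 1], the [q + 1] iterations number at most [2 * q]. *)
- by rewrite /=; lia.
- by move=> s1 [? _ _ ? eW1]; split=> // l lq; rewrite eW1 // ltnS lq.
Qed.

Lemma runs_clear k s : trace_inv k s -> imem s vj 0 = 0%N ->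
  runs (While (BNot (ILe (Var vq) (Var vj))) clear_body) s (100 * q)
    (clear_inv k q).
Proof.
move=> sI ej; apply: (@runs_weaken _ _ _ _ _ (clear_inv k q)); last by [].
  have : clear_inv k 0 s by [].
  apply: runs_while => [j s1 jq|s1]; last first.
    by case=> -[[_ eq _ _ _] _ _ _] /= -> _; rewrite /= eq leqnn.
  case=> -[[{}ep eq ei eb eD] ec eT eX] {}ej eZ.
  split; first by rewrite /= eq ej -ltnNge.
  apply: runs_wp => /=; rewrite ej eb addn1; split=> //; last first.
    move=> l; rewrite /upd /= eqn_add2l ltnS leq_eqVlt.
    by case: eqP => //= _; apply: eZ.
  split=> // i l ik lq; rewrite /upd /=; case: eqP => [|_]; last exact: eX.
  by nia.
by rewrite /=; lia.
Qed.

Lemma runs_trace k s : (k < p)%N -> trace_inv k s ->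
  runs trace_body s (200 * q) (trace_inv k.+1).
Proof.
move=> kp sI; apply: (@runs_weaken _ _ _ _ _ (trace_inv k.+1)); last by [].
  apply: (@runs_seq _ _ _ _ _ _
            (fun s1 => trace_inv k s1 /\ imem s1 vj 0 = 0%N)).
    by apply: runs_wp; case: sI.
  move=> s1 [s1I s1j]; apply: runs_seq; first exact: runs_clear s1I s1j.
  move=> s2 [[[ep eq ei eb eD] ec eT eX] _ eZ].
  have uq : (greedy_used p q D k <= q)%N.
    rewrite -used_greedy; apply: used_le (ltnW kp).
    exact: greedy_restricted_growth.
  have eTk : imem s2 aT (k * q + k + greedy_used p q D k) = greedy p q D k.
    by rewrite eT // ltnS uq; case: k {kp sI s1I ei eb ec eX eZ uq}.
  apply: runs_wp => /=; rewrite {1}/upd /= eb ei ec eTk.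
  have X' i j : (i < k.+1)%N -> (j < q)%N ->
    upd (rmem s2) aX (k * q + greedy p q D k) 1%:R aX (i * q + j)
      = (greedy p q D i == j)%:R.
    move=> ik jq; rewrite /upd eqxx /=.
    have [ik'|->] : (i < k)%N \/ i = k by lia.
      (* A column index below [q] keeps the written 1 inside row [k], away from earlier rows. *)
      have gq : (greedy p q D k < q)%N.
        by have [] := greedy_restricted_growth D q_gt0 kp.
      by case: eqP => [|_]; [nia|exact: eX].
    by rewrite eqn_add2l eq_sym; case: eqP => // _; exact: eZ.
  have next : greedy_used p q D k.+1
    = next_used (greedy_used p q D k) (greedy p q D k) by [].
  case: ifP => le; rewrite /trace_inv next /next_used le; split=> //=;
    by rewrite /upd /= ?addn1 ?ec ?ei ?eb ?eq //;
       split; rewrite //= mulSn addnC.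
by rewrite /=; lia.
Qed.

Lemma runs_program s : imem s vp 0 = p -> imem s vq 0 = q ->
  (forall k, rmem s aD k = m k) ->
  runs program s (1000 * (p * q)) (trace_inv p).
Proof.
move=> sp sq sD; apply: (@runs_weaken _ _ _ _ _ (trace_inv p)); last by [].
  apply: runs_seq; first exact: runs_init.
  move=> s1 s1I; apply: (@runs_seq _ _ _ _ _ _ (row_inv p)).
    have : row_inv 0 s1.
      case: s1I => at_p eW; rewrite /row_inv subn0; split=> //.
        by move=> k l kp _ /orP[|/andP[/eqP]]; lia.
      by move=> l lq; rewrite eW ?(leq_trans lq) // /V value_end.
    apply: runs_while => [k s2 kp s2I|s2].
      split; last exact: runs_row.
      by case: s2I => -[_ _ /= -> _ _] _ _; rewrite subn_gt0.
    by case=> -[_ _ /= -> _ _] _ _; rewrite subnn.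
  move=> s2 [at_0 eT _]; rewrite subnn in at_0 eT.
  apply: (@runs_seq _ _ _ _ _ _ (trace_inv 0)); first exact: runs_wp.
  move=> s3; apply: runs_while => [k s4 kp s4I|s4].
    split; last exact: runs_trace.
    by case: s4I => -[/= -> _ -> _ _] _ _ _; rewrite -ltnNge.
  by case=> -[/= -> _ -> _ _] _ _ _; rewrite leqnn.
(* Here [1 <= q <= p] absorbs the constant terms and those linear in [p] into [p * q]. *)
by rewrite /=; nia.
Qed.

End Correctness.

Theorem corollary9 (R : realType) :
  exists (alg : cmd) (K : nat),
  forall (p q : nat), (1 <= q)%N -> (q <= p)%N ->
  forall (d : Ivec R p q) (s : state R), input_state d s ->
  exists (t : nat) (s' : state R),
    [/\ exec alg s t s',
        (t <= K * (p * q))%N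
      & exists x : Ivec R p q, output_state x s' /\ optimal_solution d x].
Proof.
exists program, 1000%N => p q q0 qp d s [sp sq sd].
(* Here [m] is the initial real array 0, so that [D] agrees with [d] on [Iset]. *)
have [t [s' [E tle [_ _ _ eX]]]] := runs_program q0 qp sp sq (fun=> erefl).
exists t, s'; split=> //; eexists; split; last first.
  exact: (@greedy_optimal R p q d (fun i j => rmem s 0 (i * q + j)%N)) sd q0.
by move=> ij; rewrite ffunE mxE; rewrite eX.
Qed.
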